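(* Let $G$ be a regular graph on $n$ vertices with adjacency eigenvalues $\lambda_1\ge\cdots\ge\lambda_n$. Then the equidistant number of $G$ satisfies $$\mathrm{eq}(G)\le n\cdot\max\left\{\frac{-\lambda_n}{\lambda_1-\lambda_n},\ \frac{1+\lambda_2}{n-\lambda_1+\lambda_2}\right\}.$$
   Context: Here $d(u,v)$ is the shortest-path distance in $G$, and adjacency eigenvalues are listed with multiplicity. For a positive integer $t$, a set $S\subseteq V(G)$ is $t$-equidistant if $d(u,v)=t$ for all distinct $u,v\in S$; $\mathrm{eq}_t(G)$ is the number of vertices in a largest $t$-equidistant set of $G$; and the equidistant number is $\mathrm{eq}(G)=\max\{\mathrm{eq}_t(G):1\le t\le\mathrm{diam}(G)\}$, where $\mathrm{diam}(G)$ is the diameter of $G$. *)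

(* Defs.v *)
From mathcomp Require Import all_boot all_order all_algebra.

Set Implicit Arguments.
Unset Strict Implicit.
Unset Printing Implicit Defensive.

Import Order.TTheory GRing.Theory Num.Theory.

(* A finite simple graph is a symmetric irreflexive relation
   [e] on a finType [V] of vertices. *)

Section Graph.
Variables (V : finType) (e : rel V).

Definition regular : Prop :=
  exists k : nat, forall v : V, #|[set w | e v w]| = k.

Definition walk (u v : V) (k : nat) : bool :=
  [exists p : k.-tuple V, path e u p && (last u p == v)].

Lemma connect_walk (u v : V) : connect e u v -> exists k, walk u v k.
Proof.
move=> /connectP[p pp ->]; exists (size p).
by apply/existsP; exists (in_tuple p); rewrite /= pp eqxx.
Qed.

(* [None] stands for an infinite distance. *)
Definition dist (u v : V) : option nat :=
  if @idP (connect e u v) is ReflectT uv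
  then Some (ex_minn (connect_walk uv)) else None.

(* Pairs at infinite distance are ignored.  This agrees with the usual diameter
   when the graph is connected; in a disconnected graph with at least one edge,
   [eqnum] below is the same as with an infinite diameter, since beyond the
   largest finite distance the t-equidistant sets have at most one element. *)
Definition diam : nat := \max_(u : V) \max_(v : V) odflt 0 (dist u v).

Definition equidistant (t : nat) (S : {set V}) : bool :=
  [forall u in S, forall v in S, (u != v) ==> (dist u v == Some t)].

Definition eqnum_at (t : nat) : nat :=
  \max_(S : {set V} | equidistant t S) #|S|.

Definition eqnum : nat := \max_(1 <= t < diam.+1) eqnum_at t.

Local Open Scope ring_scope.

Definition adjmx (R : nzRingType) : 'M[R]_#|V| :=
  \matrix_(i, j) (e (enum_val i) (enum_val j))%:R.

End Graph.

Local Open Scope ring_scope.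

(* [lam 1 >= ... >= lam n] are the eigenvalues of [A] with multiplicity;
   the values of [lam] outside [1, n] are irrelevant. *)
Definition eigenvalues_desc (R : rcfType) (n : nat) (A : 'M[R]_n)
    (lam : nat -> R) : Prop :=
  (forall i : nat, (0 < i < n)%N -> lam i.+1 <= lam i) /\
  char_poly A = \prod_(1 <= i < n.+1) ('X - (lam i)%:P).

(* Main.v *)
(* A t-equidistant set is a clique when t = 1 and an independent set when t > 1,
   so the two terms of the maximum are the Hoffman bounds for independent sets of
   G and of its complement.  Both come from evaluating the quadratic form of the
   adjacency matrix at n 1_S - |S| 1, which is orthogonal to the all-ones
   eigenvector: the form lies between lam n and lam 2 times the squared norm.
   These Rayleigh estimates follow from unitary diagonalization over R[i].  For
   the one with lam 2, given x orthogonal to an eigenvector u for lam 1, a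
   suitable x - c u has no component along the first vector of a diagonalizing
   basis, and subtracting c u adds exactly lam 1 |c|^2 |u|^2 to the form. *)
Require Import Defs.
From mathcomp Require Import all_boot all_order all_algebra.
From mathcomp Require Import complex ring lra zify.

Set Implicit Arguments.
Unset Strict Implicit.
Unset Printing Implicit Defensive.

Import Order.TTheory GRing.Theory Num.Theory.
Local Open Scope ring_scope.
Local Open Scope sesquilinear_scope.

(** * Quadratic forms in unitary coordinates *)

Lemma char_poly_conj (F : comUnitRingType) (n : nat) (P A : 'M[F]_n) :
  P \in unitmx -> char_poly (invmx P *m A *m P) = char_poly A.
Proof.
move=> Pu; pose c := map_mx (@polyC F).
have PK : c _ _ (invmx P) *m c _ _ P = 1%:M by rewrite -map_mxM mulVmx // map_mx1.
rewrite /char_poly /char_poly_mx !map_mxM /= -/(c _ _) -/(c _ _).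
have -> : 'X%:M - c _ _ (invmx P) *m c _ _ A *m c _ _ P
  = c _ _ (invmx P) *m ('X%:M - c _ _ A) *m c _ _ P.
  by rewrite mulmxBr mulmxBl mul_mx_scalar -scalemxAl PK scalemx1.
by rewrite !det_mulmx mulrAC -det_mulmx PK det1 mul1r.
Qed.

Lemma char_poly_diag (F : comNzRingType) (n : nat) (d : 'rV[F]_n) :
  char_poly (diag_mx d) = \prod_(i < n) ('X - (d 0 i)%:P).
Proof.
rewrite char_poly_trig ?diag_mx_is_trig //.
by apply: eq_bigr => i _; rewrite !mxE eqxx.
Qed.

Lemma unitary_diag_form (C : numClosedFieldType) (m : nat) (P : 'M[C]_m)
    (d w : 'rV[C]_m) :
  (w *m (P^t* *m diag_mx d *m P) *m w^t*) 0 0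
    = \sum_i d 0 i * `|(w *m P^t*) 0 i| ^+ 2.
Proof.
have -> : w *m (P^t* *m diag_mx d *m P) *m w^t*
    = (w *m P^t*) *m diag_mx d *m (w *m P^t*)^t*.
  by rewrite trmx_mul map_mxM /= trmxCK !mulmxA.
rewrite mul_mx_diag mxE; apply: eq_bigr => i _.
by rewrite !mxE normCK; ring.
Qed.

Lemma unitary_norm (C : numClosedFieldType) (m : nat) (P : 'M[C]_m)
    (w : 'rV[C]_m) : P \is unitarymx ->
  (w *m w^t*) 0 0 = \sum_i `|(w *m P^t*) 0 i| ^+ 2.
Proof.
move=> Pu; have := unitary_diag_form P (const_mx 1) w.
rewrite diag_const_mx mulmx1 -[P^t* *m P]mulmx1.
have -> : P^t* *m P = 1%:M by apply: mulmx1C; apply/unitarymxP.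
by rewrite !mulmx1 => ->; apply: eq_bigr => i _; rewrite mxE mul1r.
Qed.

(** The two hypotheses of orthogonality kill the cross terms: one directly, the other after [u *m B]
    is replaced by [mu *: u]. With [B = 1] and [mu = 1] the same identity computes the squared norm
    of [x - c *: u]. *)
Lemma form_sub_ortho (C : numClosedFieldType) (m : nat) (B : 'M[C]_m)
    (x u : 'rV[C]_m) (c mu : C) :
  u *m B = mu *: u -> x *m B *m u^t* = 0 -> u *m x^t* = 0 ->
  ((x - c *: u) *m B *m (x - c *: u)^t*) 0 0
    = (x *m B *m x^t*) 0 0 + `|c| ^+ 2 * (mu * (u *m u^t*) 0 0).
Proof.
move=> uB xu ux.
have -> : (x - c *: u)^t* = x^t* - c^* *: u^t*.
  by rewrite linearB linearZ /= map_mxB map_mxZ.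
rewrite !(mulmxBl, mulmxBr) -!(scalemxAl, scalemxAr) uB xu -!scalemxAl ux.
by rewrite !scaler0 subr0 sub0r opprK !scalerA mxE [in X in _ + X]mxE normCK; ring.
Qed.

Lemma mulmx_row_subZ (F : pzRingType) (m p : nat) (x u : 'rV[F]_m) (c : F)
    (Q : 'M[F]_(m, p)) (i : 'I_p) :
  ((x - c *: u) *m Q) 0 i = (x *m Q) 0 i - c * (u *m Q) 0 i.
Proof. by rewrite mulmxBl -scalemxAl mxE [in X in _ + X]mxE [X in - X]mxE. Qed.

(** * Rayleigh bounds for a real symmetric matrix *)

Section Spectral.
Variables (R : rcfType) (n : nat) (A : 'M[R]_n) (lam : nat -> R).
Hypotheses (symA : A^T = A) (lamP : eigenvalues_desc A lam).

Local Notation toC := (real_complex R).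
Local Notation MtoC := (map_mx toC).

Lemma eigenvalues_desc_le (i j : nat) :
  (0 < i)%N -> (i <= j)%N -> (j <= n)%N -> lam j <= lam i.
Proof.
move=> i0; elim: j => [|j IH]; first by rewrite leqn0 => /eqP ->.
rewrite leq_eqVlt => /orP[/eqP -> //|ij jn].
apply: le_trans (IH ij (ltnW jn)); apply: lamP.1.
by rewrite jn (leq_trans i0).
Qed.

Lemma eigenvalue_desc (a : R) :
  eigenvalue A a = (a \in [seq lam i | i <- index_iota 1 n.+1]).
Proof.
rewrite eigenvalue_root_char lamP.2.
by rewrite -(big_map lam xpredT (fun z => 'X - z%:P)) root_prod_XsubC.
Qed.

(** A real symmetric matrix is normal over [R[i]], hence unitarily diagonalizable. Two
    factorizations of its characteristic polynomial into linear factors agree as multisets of roots,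
    so the diagonal consists of the [lam i], and in particular is real. *)
Lemma real_unitary_diag : exists (P : 'M[R[i]]_n) (d : 'I_n -> R),
  [/\ P \is unitarymx,
      MtoC A = P^t* *m diag_mx (\row_i toC (d i)) *m P &
      perm_eq [seq d i | i <- enum 'I_n] [seq lam i | i <- index_iota 1 n.+1]].
Proof.
have realA : MtoC A \is a realmx.
  by apply/mxOverP=> i j; rewrite mxE complex_real.
have symC : MtoC A \is symmetricmx.
  by apply/is_hermitianmxP; rewrite expr0 scale1r map_mx_id // map_trmx symA.
have Anorm := symmetric_normalmx symC realA.
have /orthomx_spectralP Aeq := Anorm.
set P := spectralmx _ in Aeq; set D := spectral_diag _ in Aeq.
have Pu : P \is unitarymx by apply: spectral_unitarymx.
have : perm_eq [seq D 0 i | i <- enum 'I_n]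
           (map toC [seq lam i | i <- index_iota 1 n.+1]).
  apply: prod_XsubC_eq; rewrite !big_map.
  transitivity (char_poly (MtoC A)).
    by rewrite Aeq char_poly_conj ?spectral_unit // char_poly_diag [index_enum _]unlock.
  transitivity (map_poly (real_complex R : {rmorphism R -> R[i]}) (char_poly A)).
    by rewrite map_char_poly.
  rewrite lamP.2 rmorph_prod; apply: eq_bigr => i _.
  by rewrite /= rmorphB /= map_polyX map_polyC.
move=> pD.
have Dreal i : D 0 i = toC (complex.Re (D 0 i)).
  have : D 0 i \in [seq D 0 i | i <- enum 'I_n] by rewrite map_f ?mem_enum.
  by rewrite (perm_mem pD) => /mapP[r _ ->].
exists P, (fun i => complex.Re (D 0 i)); split => //.
  have -> : \row_i toC (complex.Re (D 0 i)) = D by apply/rowP => i; rewrite mxE -Dreal.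
  by rewrite -(invmx_unitary Pu).
have := perm_map (@complex.Re R) pD.
by rewrite -!map_comp.
Qed.

Lemma toC_form (B : 'M[R]_n) (x y : 'rV[R]_n) :
  (MtoC x *m MtoC B *m (MtoC y)^t*) 0 0 = toC ((x *m B *m y^T) 0 0).
Proof.
have -> : (MtoC y)^t* = MtoC y^T.
  by apply/matrixP=> i j; rewrite !mxE conj_Creal // complex_real.
by rewrite -!map_mxM mxE.
Qed.

Lemma toC_norm (x y : 'rV[R]_n) :
  (MtoC x *m (MtoC y)^t*) 0 0 = toC ((x *m y^T) 0 0).
Proof. by rewrite -[x in RHS]mulmx1 -toC_form map_mx1 mulmx1. Qed.

Lemma form_bounds (x : 'rV[R]_n) :
  lam n * (x *m x^T) 0 0 <= (x *m A *m x^T) 0 0 <= lam 1%N * (x *m x^T) 0 0.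
Proof.
have [P [d [Pu AE pd]]] := real_unitary_diag.
have d_le i : lam n <= d i <= lam 1%N.
  have : d i \in [seq d i | i <- enum 'I_n] by rewrite map_f ?mem_enum.
  rewrite (perm_mem pd) => /mapP[j]; rewrite mem_index_iota ltnS => /andP[j0 jn] ->.
  by rewrite !eigenvalues_desc_le // (leq_trans j0).
rewrite -!lecR -toC_form AE unitary_diag_form !rmorphM /= -toC_norm.
rewrite (unitary_norm _ Pu) !mulr_sumr; apply/andP.
by split; apply: ler_sum => i _; apply: ler_wpM2r; rewrite ?exprn_ge0 // mxE lecR;
  case/andP: (d_le i).
Qed.

Lemma form_le_second (u x : 'rV[R]_n) : (1 < n)%N -> u != 0 ->
  u *m A = lam 1%N *: u -> x *m u^T = 0 ->
  (x *m A *m x^T) 0 0 <= lam 2%N * (x *m x^T) 0 0.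
Proof.
move=> n1 u0 uA xu.
have [P [d [Pu AE pd]]] := real_unitary_diag.
(* [i1] carries one copy of [lam 1]. Removing that copy leaves [lam 2], ..., [lam n] with
   multiplicity, even if [lam 1] is a multiple eigenvalue. *)
have [i1 le_d2] : exists i1, forall i, i != i1 -> d i <= lam 2%N.
  have : lam 1%N \in [seq d i | i <- enum 'I_n].
    by rewrite (perm_mem pd) map_f // mem_index_iota; lia.
  move=> /mapP[i1 _ l1]; exists i1 => i ii1.
  have pd' : perm_eq [seq lam i | i <- iota 2 n.-1]
                     [seq d i | i <- rem i1 (enum 'I_n)].
    rewrite -(perm_cons (lam 1%N)) {2}l1 -[_ :: [seq d i | i <- _]]/(map d (i1 :: _)).
    have -> : lam 1%N :: [seq lam i | i <- iota 2 n.-1]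
        = [seq lam i | i <- index_iota 1 n.+1].
      by rewrite /index_iota subSS subn0 -(ltn_predK n1).
    rewrite perm_sym; apply: perm_trans pd; apply: perm_map.
    by rewrite perm_sym perm_to_rem // mem_enum.
  have : d i \in [seq d i | i <- rem i1 (enum 'I_n)].
    by rewrite map_f // (mem_rem_uniq _ (enum_uniq _)) !inE ii1 mem_enum.
  rewrite -(perm_mem pd') => /mapP[j]; rewrite mem_iota => /andP[j2 jn] ->.
  by apply: eigenvalues_desc_le; lia.
have form_le2 (w : 'rV[R[i]]_n) : (w *m P^t*) 0 i1 = 0 ->
    (w *m MtoC A *m w^t*) 0 0 <= toC (lam 2%N) * (w *m w^t*) 0 0.
  move=> w1; rewrite AE unitary_diag_form (unitary_norm _ Pu) mulr_sumr.
  apply: ler_sum => i _; have [->|ii1] := eqVneq i i1.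
    by rewrite w1 normr0 expr0n !mulr0.
  by apply: ler_wpM2r; [exact: exprn_ge0|rewrite mxE lecR le_d2].
have Au : A *m u^T = lam 1%N *: u^T.
  by rewrite -linearZ /= -uA trmx_mul symA.
have ux : u *m x^T = 0 by rewrite -[u]trmxK -trmx_mul xu trmx0.
have uu0 : 0 < (u *m u^T) 0 0.
  have sq_ge0 i : true -> 0 <= u 0 i * u^T i 0 by rewrite mxE -expr2 sqr_ge0.
  rewrite mxE lt_def sumr_ge0 // andbT; apply: contra u0 => /eqP.
  move=> /(psumr_eq0P sq_ge0) z; apply/eqP/rowP => i; rewrite mxE.
  by have /eqP := z i isT; rewrite mxE -expr2 sqrf_eq0 => /eqP.
(* If [u] has no component at [i1], then [form_le2] applies to [u] itself and yields
   [lam 1 <= lam 2], so the general upper Rayleigh bound for [x] suffices. *)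
have [a0|a0] := eqVneq ((MtoC u *m P^t*) 0 i1) 0.
  have := form_le2 _ a0; rewrite toC_form toC_norm -rmorphM lecR uA.
  rewrite -scalemxAl mxE ler_pM2r // => l12.
  case/andP: (form_bounds x) => _ /le_trans; apply; apply: ler_wpM2r => //.
  by rewrite mxE sumr_ge0 // => i _; rewrite mxE -expr2 sqr_ge0.
(* This [c] cancels the component of [x] at [i1]. *)
pose c := (MtoC x *m P^t*) 0 i1 / (MtoC u *m P^t*) 0 i1.
have /form_le2 : ((MtoC x - c *: MtoC u) *m P^t*) 0 i1 = 0.
  by rewrite mulmx_row_subZ /c divfK ?subrr.
have uC : (MtoC u)^t* = MtoC u^T.
  by apply/matrixP=> i j; rewrite !mxE conj_Creal // complex_real.
have xC : (MtoC x)^t* = MtoC x^T.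
  by apply/matrixP=> i j; rewrite !mxE conj_Creal // complex_real.
rewrite (@form_sub_ortho _ _ _ _ _ _ (toC (lam 1%N))); last 3 first.
- by rewrite -map_mxM uA map_mxZ.
- by rewrite uC -!map_mxM -mulmxA Au -scalemxAr xu scaler0 map_mx0.
- by rewrite xC -map_mxM ux map_mx0.
(* The squared norm is rewritten as the form of the identity matrix, for which [u] has eigenvalue
   1. *)
rewrite -[X in toC (lam 2%N) * (X *m _) 0 0]mulmx1.
rewrite (@form_sub_ortho _ _ 1%:M _ _ _ 1); last 3 first.
- by rewrite mulmx1 scale1r.
- by rewrite mulmx1 uC -map_mxM xu map_mx0.
- by rewrite xC -map_mxM ux map_mx0.
rewrite mulmx1 !toC_form !toC_norm mul1r.
set q := (x *m A *m _) 0 0; set xx := (x *m _) 0 0; set uu := (u *m _) 0 0.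
have -> : `|c| ^+ 2 = toC (complex.Re (`|c| ^+ 2)).
  by rewrite RRe_real // ger0_real // exprn_ge0.
set r := complex.Re _.
have r0 : 0 <= r by rewrite -lecR RRe_real ?ger0_real // exprn_ge0.
have l21 : lam 2%N <= lam 1%N by apply: lamP.1.
have ruu0 : 0 <= (lam 1%N - lam 2%N) * (r * uu).
  by rewrite mulr_ge0 ?subr_ge0 ?mulr_ge0 // ltW.
rewrite -!rmorphM -!rmorphD -rmorphM lecR => form_le; lra.
Qed.

End Spectral.

(** * Equidistant sets as cliques and independent sets *)

Section DistanceOne.
Variables (V : finType) (e : rel V).

Lemma dist_Some (t : nat) (u v : V) : dist e u v = Some t ->
  walk e u v t /\ forall m, walk e u v m -> (t <= m)%N.
Proof.
rewrite /dist.
(* [uv : connect e u v] forces a match generalizing only the index of [reflect]. *)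
refine (match @idP (connect e u v) as r in reflect _ b
  return (if r is ReflectT uv then Some (ex_minn (connect_walk uv)) else None)
           = Some t -> _ with ReflectT uv => _ | ReflectF _ => _ end) => //.
by case: ex_minnP => m walk_m min_m [<-].
Qed.

Lemma walk1 (u v : V) : walk e u v 1 = e u v.
Proof.
apply/existsP/idP => [[p]|euv]; last by exists [tuple v]; rewrite /= euv eqxx.
by case/tupleP: p => w p; rewrite tuple0 /= andbT => /andP[euw /eqP <-].
Qed.

Lemma dist_adjacent (u v : V) : dist e u v = Some 1%N -> e u v.
Proof. by case/dist_Some; rewrite walk1. Qed.

Lemma dist_nonadjacent (t : nat) (u v : V) :
  (1 < t)%N -> dist e u v = Some t -> ~~ e u v.
Proof.
move=> t1 /dist_Some[_ min_t]; apply: contraL t1 => euv.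
by rewrite -leqNgt min_t // walk1.
Qed.

Lemma equidistant1_clique (S : {set V}) :
  equidistant e 1 S -> {in S &, forall u v, u != v -> e u v}.
Proof.
move=> /forall_inP eqS u v uS vS uv.
have /forall_inP/(_ v vS) := eqS u uS.
by rewrite uv => /eqP/dist_adjacent.
Qed.

Lemma equidistant_independent (t : nat) (S : {set V}) :
  (1 < t)%N -> irreflexive e -> equidistant e t S ->
  {in S &, forall u v, ~~ e u v}.
Proof.
move=> t1 e_irr /forall_inP eqS u v uS vS.
have /forall_inP/(_ v vS) := eqS u uS.
have [->|_ /eqP] := eqVneq u v; first by rewrite e_irr.
exact: dist_nonadjacent.
Qed.

End DistanceOne.

(** * Hoffman bounds for regular graphs *)

Section RegularGraph.
Variables (R : rcfType) (V : finType) (e : rel V) (k : nat) (lam : nat -> R).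
Hypotheses (e_sym : symmetric e) (e_deg : forall v, #|[set w | e v w]| = k).
Hypothesis lamP : eigenvalues_desc (adjmx e R) lam.

Local Notation A := (adjmx e R).
Local Notation n := #|V|.
Local Notation one := (const_mx 1 : 'rV[R]_n).

Lemma trmx_adjmx : A^T = A.
Proof. by apply/matrixP => i j; rewrite !mxE e_sym. Qed.

Lemma sum_adjmx (j : 'I_n) : \sum_i A i j = k%:R.
Proof.
rewrite -(e_deg (enum_val j)) -sum1_card natr_sum.
rewrite (eq_bigl (e (enum_val j))); last by move=> w; rewrite inE.
rewrite [RHS]big_mkcond /= [RHS](reindex _ (onW_bij _ (@enum_val_bij V))).
by apply: eq_bigr => i _; rewrite mxE e_sym; case: (e _ _).
Qed.

Lemma one_adjmx : one *m A = k%:R *: one.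
Proof.
apply/rowP => j; rewrite !mxE mulr1 -(sum_adjmx j).
by apply: eq_bigr => i _; rewrite mxE mul1r.
Qed.

Lemma lam1_degree : (0 < n)%N -> lam 1%N = k%:R.
Proof.
move=> n0; apply/eqP; rewrite eq_le; apply/andP; split; last first.
  have : eigenvalue A k%:R.
    apply/eigenvalueP; exists one; first exact: one_adjmx.
    by apply/rV0Pn; exists (Ordinal n0); rewrite mxE oner_eq0.
  rewrite (eigenvalue_desc lamP) => /mapP[j]; rewrite mem_index_iota => /andP[j0 jn] ->.
  by apply: (eigenvalues_desc_le lamP); lia.
have : eigenvalue A (lam 1%N).
  by rewrite (eigenvalue_desc lamP) map_f // mem_index_iota; lia.
case/eigenvalueP => v vA /rV0Pn[i0 vi0].
(* At an entry [i] of largest absolute value, [lam 1 * v 0 i] is a sum of [k] entries of [v], each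
   at most [|v 0 i|] in absolute value. *)
case: (Order.TotalTheory.arg_maxP (fun i => `|v 0 i|) (isT : xpredT i0)) => i _ max_i.
have vi : 0 < `|v 0 i| by apply: lt_le_trans (max_i i0 isT); rewrite normr_gt0.
rewrite -(ler_pM2r vi); apply: le_trans (ler_wpM2r (ltW vi) (ler_norm _)) _.
have := congr1 (fun M : 'rV_n => M 0 i) vA; rewrite /= !mxE -normrM => <-.
rewrite -(sum_adjmx i) mulr_suml; apply: le_trans (ler_norm_sum _ _ _) _.
apply: ler_sum => j _; rewrite normrM mulrC mxE ger0_norm ?ler0n //.
by rewrite ler_wpM2l ?ler0n //; apply: max_i.
Qed.

(** Ordered pairs are counted, so for a simple graph this is twice the number of edges inside
    [S]. *)
Definition edges_in (S : {set V}) : nat := (\sum_(u in S) \sum_(v in S) e u v)%N.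

Definition indicator (S : {set V}) : 'rV[R]_n := \row_i (enum_val i \in S)%:R.

Lemma indicator_form (S : {set V}) :
  (indicator S *m A *m (indicator S)^T) 0 0 = (edges_in S)%:R.
Proof.
rewrite /edges_in natr_sum [RHS]big_mkcond /=.
rewrite [RHS](reindex _ (onW_bij _ (@enum_val_bij V))) /= -mulmxA mxE.
apply: eq_bigr => i _; rewrite mxE mulr_natl mulrb; case: ifP => // _.
rewrite mxE natr_sum [RHS]big_mkcond [RHS](reindex _ (onW_bij _ (@enum_val_bij V))) /=.
by apply: eq_bigr => j _; rewrite !mxE mulr_natr mulrb.
Qed.

Lemma sum_indicator (S : {set V}) : \sum_i indicator S 0 i = #|S|%:R.
Proof.
rewrite -sum1_card natr_sum [RHS]big_mkcond /=.
rewrite [RHS](reindex _ (onW_bij _ (@enum_val_bij V))) /=.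
by apply: eq_bigr => i _; rewrite mxE; case: ifP.
Qed.

Lemma indicator_one (S : {set V}) : (indicator S *m one^T) 0 0 = #|S|%:R.
Proof.
by rewrite mxE -sum_indicator; apply: eq_bigr => i _; rewrite !mxE mulr1.
Qed.

Lemma indicator_norm (S : {set V}) :
  (indicator S *m (indicator S)^T) 0 0 = #|S|%:R.
Proof.
rewrite mxE -sum_indicator; apply: eq_bigr => i _; rewrite !mxE.
by rewrite -natrM mulnb andbb.
Qed.

(** This is [n] times the projection of the indicator onto the complement of the all-ones vector;
    the scaling avoids division by [n]. *)
Definition balanced_indicator (S : {set V}) : 'rV[R]_n :=
  n%:R *: indicator S - #|S|%:R *: one.

Lemma one_norm : (one *m one^T) 0 0 = n%:R.
Proof.
rewrite mxE (eq_bigr (fun=> 1)) => [|i _]; last by rewrite !mxE mulr1.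
by rewrite sumr_const card_ord.
Qed.

Lemma balanced_indicator_ortho (S : {set V}) :
  balanced_indicator S *m one^T = 0.
Proof.
apply/matrixP => i j; rewrite !ord1 mulmxBl -!scalemxAl.
have E (M N : 'M[R]_1) a b : (a *: M - b *: N) 0 0 = a * M 0 0 - b * N 0 0.
  by rewrite !mxE.
by rewrite E indicator_one one_norm mulrC subrr mxE.
Qed.

(** By symmetry the all-ones vector is an eigenvector on both sides, so the all-ones part of the
    right factor contributes nothing. [B] is kept general to cover both the adjacency matrix and,
    with the identity, the norm. *)
Lemma balanced_form (S : {set V}) (B : 'M[R]_n) (b : R) :
  B^T = B -> one *m B = b *: one ->
  (balanced_indicator S *m B *m (balanced_indicator S)^T) 0 0
    = n%:R * (n%:R * (indicator S *m B *m (indicator S)^T) 0 0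
              - b * #|S|%:R ^+ 2).
Proof.
move=> symB oneB.
have Bone : B *m one^T = b *: one^T by rewrite -linearZ /= -oneB trmx_mul symB.
have ortho : balanced_indicator S *m B *m one^T = 0.
  by rewrite -mulmxA Bone -scalemxAr balanced_indicator_ortho scaler0.
have -> : (balanced_indicator S)^T = n%:R *: (indicator S)^T - #|S|%:R *: one^T.
  by rewrite linearB !linearZ.
rewrite mulmxBr -!scalemxAr ortho.
rewrite scaler0 subr0 /balanced_indicator mulmxBl -!scalemxAl oneB mulmxBl -!scalemxAl.
have onei : (one *m (indicator S)^T) 0 0 = #|S|%:R.
  by rewrite -[one *m _]trmxK mxE trmx_mul trmxK indicator_one.
have E (M N : 'M[R]_1) a c d : (a *: (c *: M - d *: (b *: N))) 0 0
    = a * (c * M 0 0 - d * (b * N 0 0)).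
  by rewrite !mxE.
by rewrite E onei; ring.
Qed.

Lemma balanced_adjmx_form (S : {set V}) :
  (balanced_indicator S *m A *m (balanced_indicator S)^T) 0 0
    = n%:R * (n%:R * (edges_in S)%:R - k%:R * #|S|%:R ^+ 2).
Proof. by rewrite (balanced_form _ trmx_adjmx one_adjmx) indicator_form. Qed.

Lemma balanced_norm (S : {set V}) :
  (balanced_indicator S *m (balanced_indicator S)^T) 0 0
    = n%:R * (#|S|%:R * (n%:R - #|S|%:R)).
Proof.
rewrite -[X in X *m _]mulmx1 (@balanced_form _ _ 1) ?trmx1 ?mulmx1 ?scale1r //.
by rewrite indicator_norm; ring.
Qed.

(* This and [edges_in_le] are the expander mixing lemma for the pair [(S, S)]. *)
Lemma edges_in_ge (S : {set V}) : (0 < n)%N ->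
  lam n * (#|S|%:R * (n%:R - #|S|%:R))
    <= n%:R * (edges_in S)%:R - k%:R * #|S|%:R ^+ 2.
Proof.
move=> n0; have nR : (0 : R) < n%:R by rewrite ltr0n.
have /andP[+ _] := form_bounds trmx_adjmx lamP (balanced_indicator S).
by rewrite balanced_adjmx_form balanced_norm mulrCA ler_pM2l.
Qed.

Lemma edges_in_le (S : {set V}) : (1 < n)%N ->
  n%:R * (edges_in S)%:R - k%:R * #|S|%:R ^+ 2
    <= lam 2%N * (#|S|%:R * (n%:R - #|S|%:R)).
Proof.
move=> n1; have n0 : (0 < n)%N by lia.
have nR : (0 : R) < n%:R by rewrite ltr0n.
have one_neq0 : one != 0.
  by apply/rV0Pn; exists (Ordinal n0); rewrite mxE oner_eq0.
have oneA : one *m A = lam 1%N *: one by rewrite lam1_degree // one_adjmx.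
have := form_le_second trmx_adjmx lamP n1 one_neq0 oneA (balanced_indicator_ortho S).
by rewrite balanced_adjmx_form balanced_norm [lam 2%N * (_ * _)]mulrCA ler_pM2l.
Qed.

(** No edges lie inside [S], so the lower mixing bound, divided by [#|S|], becomes linear in
    [#|S|]. *)
Lemma independent_bound (S : {set V}) : S != set0 ->
  {in S &, forall u v, ~~ e u v} ->
  #|S|%:R * (lam 1%N - lam n) <= n%:R * - lam n.
Proof.
move=> S0 indS; have s0 : (0 < #|S|)%N by rewrite card_gt0.
have n0 : (0 < n)%N := leq_trans s0 (max_card _).
have := edges_in_ge S n0.
have -> : edges_in S = 0%N.
  rewrite /edges_in big1 // => u uS; rewrite big1 // => v vS.
  by rewrite (negbTE (indS u v uS vS)).
have sR : (0 : R) < #|S|%:R by rewrite ltr0n.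
rewrite (lam1_degree n0) => h; rewrite -(ler_pM2l sR); lra.
Qed.

(** Each vertex of [S] has [#|S| - 1] neighbours in [S]; the upper mixing bound is then divided by
    [#|S|]. This avoids passing to the complement graph. *)
Lemma clique_bound (S : {set V}) : (1 < n)%N -> irreflexive e -> S != set0 ->
  {in S &, forall u v, u != v -> e u v} ->
  #|S|%:R * (n%:R - lam 1%N + lam 2%N) <= n%:R * (1 + lam 2%N).
Proof.
move=> n1 e_irr S0 clS; have s0 : (0 < #|S|)%N by rewrite card_gt0.
have := edges_in_le S n1.
have -> : (edges_in S = #|S| * #|S|.-1)%N.
  rewrite /edges_in -sum_nat_const; apply: eq_bigr => u uS.
  rewrite (bigD1 u) //= e_irr add0n (eq_bigr (fun=> 1%N)).
    rewrite sum1_card (cardsD1 u S) uS /=; apply: eq_card => v.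
    by rewrite !inE andbC.
  by move=> v /andP[vS vu]; rewrite clS // eq_sym.
have sR : (0 : R) < #|S|%:R by rewrite ltr0n.
have -> : (#|S| * #|S|.-1)%:R = #|S|%:R * (#|S|%:R - 1) :> R.
  by rewrite natrM -[X in X%:R - 1](prednK s0) -natr1 addrK.
rewrite (lam1_degree (ltnW n1)) => h; rewrite -(ler_pM2l sR); lra.
Qed.

Lemma degree_lt : (0 < n)%N -> irreflexive e -> (k < n)%N.
Proof.
move=> n0 e_irr; pose v := enum_val (Ordinal n0).
rewrite -(e_deg v) -cardsT proper_card // properT.
by apply/eqP => /setP/(_ v); rewrite !inE e_irr.
Qed.

(** A singleton spans no edge, so the upper mixing bound gives [- k <= lam 2 * (n - 1)], while
    [k <= n - 1]. This makes the second denominator of the theorem nonnegative. *)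
Lemma lam2_geN1 : (1 < n)%N -> irreflexive e -> - 1 <= lam 2%N.
Proof.
move=> n1 e_irr; have n0 := ltnW n1.
pose v := enum_val (Ordinal n0).
have := edges_in_le [set v] n1.
rewrite /edges_in !big_set1 e_irr cards1 mulr0 sub0r mul1r expr1n mulr1 => h.
have kn := degree_lt n0 e_irr.
have kR : k%:R <= n%:R - 1 :> R by rewrite lerBrDr natr1 ler_nat.
have n1R : (0 : R) < n%:R - 1 by rewrite subr_gt0 ltr1n.
by rewrite -(ler_pM2r n1R) mulN1r (le_trans _ h) // lerN2.
Qed.

End RegularGraph.

Theorem corollary29 (R : rcfType) (V : finType) (e : rel V)
    (e_sym : symmetric e) (e_irr : irreflexive e) (e_reg : regular e)
    (n : nat) (card_V : #|V| = n) (n_gt1 : (1 < n)%N)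
    (lam : nat -> R) (lamP : eigenvalues_desc (adjmx e R) lam)
    (den1_neq0 : lam 1%N - lam n != 0)
    (den2_neq0 : n%:R - lam 1%N + lam 2%N != 0) :
  (eqnum e)%:R <=
    n%:R * Num.max (- lam n / (lam 1%N - lam n))
                   ((1 + lam 2%N) / (n%:R - lam 1%N + lam 2%N)).
Proof.
case: e_reg => k e_deg; subst n; have n0 := ltnW n_gt1.
have den1_gt0 : 0 < lam 1%N - lam #|V|.
  by rewrite lt_def den1_neq0 subr_ge0 (eigenvalues_desc_le lamP).
have den2_gt0 : 0 < #|V|%:R - lam 1%N + lam 2%N.
  rewrite lt_def den2_neq0 (lam1_degree e_sym e_deg lamP n0).
  have := lam2_geN1 e_sym e_deg lamP n_gt1 e_irr.
  have : (k.+1)%:R <= #|V|%:R :> R by rewrite ler_nat (degree_lt e_deg).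
  rewrite -natr1 /=; lra.
rewrite maxr_pMr // le_max.
set B1 := _ * (- _ / _); set B2 := _ * (_ / _).
have indB (S : {set V}) : S != set0 -> {in S &, forall u v, ~~ e u v} ->
    #|S|%:R <= B1.
  by move=> *; rewrite /B1 mulrA ler_pdivlMr // (independent_bound e_sym e_deg lamP).
(* A single vertex is an independent set. Nonnegativity handles the value 0 of an empty maximum and
   the empty set. *)
have B1_ge0 : 0 <= B1.
  pose v := enum_val (Ordinal n0).
  apply: le_trans (indB [set v] _ _); first exact: ler0n.
    by apply/set0Pn; exists v; rewrite inE.
  by move=> u w /set1P-> /set1P->; rewrite e_irr.
(* [ok] holds at 0 and is preserved by [maxn], so it passes through both nested maxima, over [t] and
   over [S]. *)
pose ok (m : nat) := (m%:R <= B1) || (m%:R <= B2).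
rewrite -/(ok _).
have ok0 : ok 0%N by rewrite /ok B1_ge0.
have okmax m p : ok m -> ok p -> ok (maxn m p) by rewrite /maxn; case: ifP.
rewrite /eqnum big_nat_cond; elim/big_ind: _ => // t /andP[/andP[t1 _] _].
rewrite /eqnum_at; elim/big_ind: _ => // S eqS.
have [->|S0] := eqVneq S set0; first by rewrite cards0.
rewrite /ok; move: t1; rewrite leq_eqVlt => /orP[/eqP t1|t1].
  rewrite /B2 mulrA ler_pdivlMr // orbC (clique_bound e_sym e_deg lamP) //.
  by apply: equidistant1_clique; rewrite t1.
by rewrite indB //; apply: equidistant_independent eqS.
Qed.
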